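(* Let $n,k,\ell$ be integers with $k>\ell\geq 2$ and \[ n\geq \frac{(\ell+2)(\ell+1)^{\ell}-(\ell+1)\ell^{\ell}}{m_{\ell}(\ell+1)}\,k^2 . \] Then every intersecting family $\mathcal F\subset\binom{[n]}{k}$ satisfies \[ \gamma_\ell(\mathcal F)\leq m_{\ell}(\ell+1)\binom{n-2\ell-1}{k-\ell-1}+(\ell+1)\ell^{\ell}k\binom{n-2\ell-2}{k-\ell-2}. \]
   Context: A family $\mathcal F$ of sets is intersecting if $F\cap F'\neq\emptyset$ for all $F,F'\in\mathcal F$. For $S\subset[n]$, $\mathcal F(\overline S)=\{F\in\mathcal F: F\cap S=\emptyset\}$. The $\ell$-diversity is $\gamma_\ell(\mathcal F)=\min_{S\in\binom{[n]}{\ell}}|\mathcal F(\overline S)|$. The covering number $\tau(\mathcal F)$ is the minimum size of a set $T$ with $T\cap F\neq\emptyset$ for all $F\in\mathcal F$. For integers $0\le \ell<k$, $m_\ell(k)$ denotes the maximum of $\gamma_\ell(\mathcal F)$ over all $n$ and all intersecting families $\mathcal F\subset\binom{[n]}{k}$ with $\tau(\mathcal F)=k$. Binomial coefficients $\binom{a}{b}$ are $0$ when $b<0$ or $b>a$. *)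

(* Defs.v *)
From mathcomp Require Import all_boot all_order all_algebra.
From Stdlib Require Import ClassicalEpsilon.
Set Implicit Arguments. Unset Strict Implicit. Unset Printing Implicit Defensive.
Import Order.TTheory GRing.Theory Num.Theory.

Definition uniform (n k : nat) (F : {set {set 'I_n}}) : Prop :=
  forall A, A \in F -> #|A| = k.

Definition intersecting (n : nat) (F : {set {set 'I_n}}) : Prop :=
  forall A B, A \in F -> B \in F -> A :&: B != set0.

Definition avoid (n : nat) (F : {set {set 'I_n}}) (S : {set 'I_n}) : {set {set 'I_n}} :=
  [set A in F | [disjoint A & S]].

(* l-diversity: min over l-subsets S of |F(\bar S)|
   (default #|F| if there is no l-subset, i.e. n < l; never used here) *)
Definition gamma (n : nat) (l : nat) (F : {set {set 'I_n}}) : nat :=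
  \big[minn/#|F|]_(S : {set 'I_n} | #|S| == l) #|avoid F S|.

(* covering number: least size of a transversal
   (default n if no transversal exists, i.e. set0 \in F) *)
Definition tau (n : nat) (F : {set {set 'I_n}}) : nat :=
  \big[minn/n]_(T : {set 'I_n} | [forall A in F, ~~ [disjoint A & T]]) #|T|.

Definition is_m_ell (l k m : nat) : Prop :=
  (exists n (F : {set {set 'I_n}}),
      [/\ uniform k F, intersecting F, tau F = k & gamma l F = m]) /\
  (forall n (F : {set {set 'I_n}}),
      uniform k F -> intersecting F -> tau F = k -> gamma l F <= m).

(* m_l(k): the maximum (chosen classically; it exists since families with
   tau = k have at most k^k members) *)
Definition m_ell (l k : nat) : nat := epsilon (inhabits 0) (is_m_ell l k).

Definition binz (a b : int) : nat :=
  if ((0 <= b) && (b <= a))%R then 'C(`|a|%N, `|b|%N) else 0.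

(* Main.v *)
(** Let [F] be a maximal intersecting family that no [l]-set hits, and let [r] be
    least such that no [l]-set hits all transversals of [F] of size at most [r].
    Among the [l]-sets hitting all transversals of size less than [r], let [S]
    minimise the number of missed transversals of size [r].  By minimality, every
    [X] with fewer than [l] points is missed by a transversal of size at most [r]
    that meets [S].  So the members of [F] missing [S] can be enumerated point by
    point: [r - 1] choices for each of the first [l] points, then [r], then [k]
    as long as the points chosen do not form a transversal.

    If [r > l + 1] this gives at most [branch_count n k l r] sets, a quantity
    decreasing in [r].  If [r = l + 1], the transversals of size [l + 1] form an
    intersecting family with covering number [l + 1], hence at most [m_ell l (l + 1)]
    of them miss [S]; these give the main term, and branching bounds the members of
    [F] containing none of them.

    The monotonicity needs [2 n >= (l + 3) k^2], which follows from the hypothesis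
    and [m_ell l (l + 1) <= (l + 1)^l].  For the latter, the sets [A :\ x], with
    [x] ranging over a member [A], are missed by disjoint subfamilies of a family
    of at most [(l + 1)^(l + 1)] sets. *)

Require Import Defs.
From mathcomp Require Import all_boot all_order all_algebra.
From mathcomp Require Import zify.
From Stdlib Require Import ClassicalEpsilon.

Set Implicit Arguments. Unset Strict Implicit. Unset Printing Implicit Defensive.

(** * Numerical estimates, from Bernoulli's inequality with denominators cleared *)

Lemma bernoulli_below r l : 0 < r -> r ^ l * (r - l) <= r * r.-1 ^ l.
Proof.
move=> r0; elim: l => [|l IH]; first by rewrite !expn0 subn0 mulnC.
apply: (@leq_trans (r ^ l * (r - l) * r.-1)).
  by rewrite expnSr -!mulnA leq_mul2l; apply/orP; right; nia.
by rewrite [r.-1 ^ _]expnSr mulnA leq_mul2r IH orbT.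
Qed.

Lemma bernoulli_above r l : r ^ l * (r + l) <= r * r.+1 ^ l.
Proof.
elim: l => [|l IH]; first by rewrite !expn0 addn0 mulnC.
apply: (@leq_trans (r ^ l * (r + l) * r.+1)).
  by rewrite expnSr -!mulnA leq_mul2l; apply/orP; right; nia.
by rewrite [r.+1 ^ _]expnSr mulnA leq_mul2r IH orbT.
Qed.

Lemma double_exp_leq l : 0 < l -> 2 * l ^ l <= l.+1 ^ l.
Proof.
by move=> l0; rewrite -(leq_pmul2l l0); have := bernoulli_above l l; nia.
Qed.

(** Controls the ratio [(k - r) / (n - l - r)] of neighbouring binomials: it is at most [k / n],
    because [k * (l + r) <= 2 * k * r <= n * r]. *)
Lemma ratio_leq n k l c d : c * k ^ 2 <= n * d -> 2 * k <= n ->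
  forall r, l <= r -> r <= k -> c * (k * (k - r)) <= d * (n - l - r).
Proof.
move=> h nk r lr rk; have [k0|k0] := posnP k; first by rewrite k0 muln0.
rewrite -(leq_pmul2l k0).
apply: (@leq_trans (n * d * (k - r))).
  by apply: leq_trans (leq_mul h (leqnn (k - r))); nia.
have : n * (k - r) <= k * (n - l - r) by nia.
by move=> h2; have := leq_mul (leqnn d) h2; nia.
Qed.

(** The binomial counts the [k]-sets that contain the [r] chosen points and miss the [l] points of
    [S]. *)
Definition branch_count (n k l r : nat) :=
  r.-1 ^ l * (r * (k ^ (r - l.+1) * 'C(n - l - r, k - r))).

(** By [bernoulli_below] the claim reduces to [r.+1 * k * (k - r) <= (r - l) * (n - l - r)]. *)
Lemma branch_count_decr n k l r :
  (l + 3) * k ^ 2 <= n * 2 -> 2 * k <= n -> l.+2 <= r < k ->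
  branch_count n k l r.+1 <= branch_count n k l r.
Proof.
move=> h nk /andP[lr rk]; rewrite /branch_count.
have r0 : 0 < r by lia.
have -> : r.+1 - l.+1 = (r - l.+1).+1 by lia.
have -> : n - l - r.+1 = (n - l - r).-1 by lia.
have -> : k - r = (k - r.+1).+1 by lia.
set N := n - l - r; set K := k - r.+1; set q := r - l.+1.
have N0 : 0 < N by rewrite /N; lia.
rewrite -(leq_pmul2l N0) /= expnS.
have dg := mul_bin_diag N K; set C1 := 'C(_.-1, _) in dg *; set C2 := 'C(_, _) in dg *.
have -> : N * (r ^ l * (r.+1 * (k * k ^ q * C1))) = k ^ q * (r ^ l * (r.+1 * k) * (N * C1)) by lia.
have -> : N * (r.-1 ^ l * (r * (k ^ q * C2))) = k ^ q * (r * r.-1 ^ l * N * C2) by lia.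
rewrite dg leq_mul2l; apply/orP; right; rewrite !mulnA leq_mul2r; apply/orP; right.
apply: (@leq_trans (r ^ l * (r - l) * N)); last by rewrite leq_mul2r bernoulli_below ?orbT.
rewrite -!mulnA leq_mul2l; apply/orP; right.
have lr' : l <= r by lia.
have := ratio_leq h nk lr' (ltnW rk); rewrite -/N.
have -> : k - r = K.+1 by rewrite /K; lia.
move=> h2; rewrite -(@leq_pmul2l 2) //.
(* Equality holds at [r = l + 2], which fixes the constant [l + 3]. *)
have h3 : 2 * r.+1 <= (r - l) * (l + 3) by nia.
have := leq_mul h3 (leqnn (k * K.+1)); have := leq_mul (leqnn (r - l)) h2; lia.
Qed.

Lemma branch_count_le n k l r :
  (l + 3) * k ^ 2 <= n * 2 -> 2 * k <= n -> l.+2 <= r <= k ->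
  branch_count n k l r <= branch_count n k l l.+2.
Proof.
move=> h nk /andP[lr]; rewrite -(subnK lr); elim: (r - l.+2) => // d IH dk.
apply: leq_trans (IH (ltnW dk)).
by apply: branch_count_decr => //; rewrite leq_addl.
Qed.

(** Up to the factor [k], [D] is the excess of the branching coefficient at [r = l + 2] over the
    coefficient of the second term; the hypothesis lets the first term absorb this excess. *)
Lemma branch_count_final n k l m :
  let D := ((l + 2) * (l + 1) ^ l - (l + 1) * l ^ l) in
  D * k ^ 2 <= n * m -> 2 * k <= n -> l.+2 <= k ->
  branch_count n k l l.+2 <=
    m * 'C(n - 2 * l - 1, k - l - 1) + (l + 1) * l ^ l * k * 'C(n - 2 * l - 2, k - l - 2).
Proof.
move=> D h nk lk; rewrite /branch_count /= subSnn expn1.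
have lk' := ltnW lk.
have := ratio_leq h nk (leqnSn l) lk'.
have -> : n - l - l.+2 = (n - 2 * l - 1).-1 by lia.
have -> : n - 2 * l - 2 = (n - 2 * l - 1).-1 by lia.
have -> : n - l - l.+1 = n - 2 * l - 1 by lia.
have -> : k - l.+2 = k - l - 2 by lia.
have -> : k - l.+1 = (k - l - 2).+1 by lia.
have -> : k - l - 1 = (k - l - 2).+1 by lia.
set N := n - 2 * l - 1; set K := k - l - 2 => h2.
have dg := mul_bin_diag N K; set C1 := 'C(N.-1, _) in dg *; set C2 := 'C(N, _) in dg *.
have h3 : D * k * C1 <= m * C2.
  rewrite -(@leq_pmul2l K.+1) //.
  have := leq_mul h2 (leqnn C1); have := leq_mul (leqnn m) (leqnn (N * C1)); rewrite {2}dg; lia.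
have : ((l + 2) * (l + 1) ^ l) * (k * C1) <= (D + (l + 1) * l ^ l) * (k * C1).
  by rewrite leq_mul2r; apply/orP; right; rewrite /D; lia.
have -> : (l + 1) ^ l = l.+1 ^ l by rewrite addn1.
by move=> h4; move: h3; rewrite mulnDl in h4; nia.
Qed.

(** Since [2 * l ^ l <= l.+1 ^ l], the bracket is at least [(l + 3) / 2 * l.+1 ^ l], and the bound
    on [m] cancels the power. *)
Lemma threshold_leq n k l m :
  0 < l -> ((l + 2) * (l + 1) ^ l - (l + 1) * l ^ l) * k ^ 2 <= n * m -> m <= l.+1 ^ l ->
  (l + 3) * k ^ 2 <= n * 2.
Proof.
move=> l0; rewrite !addn1 addn2 => h ml.
have p0 : 0 < l.+1 ^ l by rewrite expn_gt0.
rewrite -(leq_pmul2l p0).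
have d2 := double_exp_leq l0.
have h1 : (l + 3) * l.+1 ^ l <= 2 * (l.+2 * l.+1 ^ l - l.+1 * l ^ l).
  have := leq_mul (leqnn l.+1) d2; set P := l.+1 ^ l; set Q := l ^ l; nia.
have := leq_mul h1 (leqnn (k ^ 2)); have := leq_mul (leqnn n) ml; lia.
Qed.

(** * Transversals and branching in set families *)

Definition hits (T : finType) (F : {set {set T}}) (S : {set T}) : bool :=
  [forall A in F, ~~ [disjoint A & S]].

Definition above (T : finType) (F : {set {set T}}) (X : {set T}) : {set {set T}} :=
  [set A in F | X \subset A].

Definition transversals (T : finType) (F : {set {set T}}) (i : nat) : {set {set T}} :=
  [set A | hits F A & #|A| <= i].

Section Branching.

Variable T : finType.
Implicit Types (F H : {set {set T}}) (A B S X : {set T}).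

Lemma hitsP F S :
  reflect (forall A, A \in F -> ~~ [disjoint A & S]) (hits F S).
Proof. exact: forall_inP. Qed.

Lemma hitsS F S S' : S \subset S' -> hits F S -> hits F S'.
Proof.
move=> sSS' /hitsP hS; apply/hitsP => A AF.
by apply: contra (hS A AF); apply: disjointWr.
Qed.

Lemma nhitsP F S : reflect (exists2 A, A \in F & [disjoint A & S]) (~~ hits F S).
Proof.
apply: (iffP idP).
  by rewrite negb_forall_in => /exists_inP[A AF]; rewrite negbK; exists A.
by case=> A AF dAS; apply/negP => /hitsP/(_ A AF); rewrite dAS.
Qed.

Lemma exists_superset (S U : {set T}) l : S \subset U -> #|S| <= l -> l <= #|U| ->
  exists2 S' : {set T}, (S \subset S') && (S' \subset U) & #|S'| = l.
Proof.
move=> sSU Sl lU; pose p := [pred A : {set T} | (S \subset A) && (A \subset U) && (#|A| <= l)].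
have pS : p S by rewrite /= subxx sSU.
have [A /andP[/= /andP[sA sAU] Al] Amax] := @arg_maxnP _ S p (fun A => #|A|) pS.
exists A; first by rewrite sA.
apply/eqP; rewrite eqn_leq Al leqNgt; apply/negP => ltA.
have : 0 < #|U :\: A| by rewrite cardsDS // subn_gt0 (leq_trans ltA).
case/card_gt0P => x; rewrite inE => /andP[xA xU].
have := Amax (x |: A); rewrite /= cardsU1 xA ltA (subset_trans sA (subsetUr _ _)).
by rewrite subUset sub1set xU sAU => /(_ isT); rewrite /= add1n ltnn.
Qed.

(** Each counted [B] meets [A] but misses [S], so it passes through one of at most [a] points of
    [A :\: S]; such a point is new because [A] misses [X]. *)
Lemma branch_step H S j a c :
    (forall B, B \in H -> [disjoint B & S]) ->
    (forall X, #|X| = j -> [disjoint X & S] -> above H X != set0 ->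
       exists A, [/\ [disjoint A & X], #|A :\: S| <= a &
                     forall B, B \in above H X -> ~~ [disjoint A & B]]) ->
    (forall X, #|X| = j.+1 -> [disjoint X & S] -> #|above H X| <= c) ->
  forall X, #|X| = j -> [disjoint X & S] -> #|above H X| <= a * c.
Proof.
move=> dHS br next X Xj dXS.
have [->|nz] := eqVneq (above H X) set0; first by rewrite cards0.
have [A [dAX Aa Ahit]] := br X Xj dXS nz.
have sub : above H X \subset \bigcup_(x in A :\: S) above H (x |: X).
  apply/subsetP => B BX; have := Ahit B BX.
  move: BX; rewrite inE => /andP[BH sXB].
  rewrite -setI_eq0 => /set0Pn[x /setIP[xA xB]].
  apply/bigcupP; exists x; last by rewrite inE BH subUset sub1set xB.
  by rewrite inE xA andbT (disjointFr (dHS B BH) xB).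
apply: leq_trans (subset_leq_card sub) _.
apply: (@leq_trans (\sum_(x in A :\: S) #|above H (x |: X)|)).
  elim/big_rec2: _ => [|x m U _ IH]; first by rewrite cards0.
  by apply: leq_trans (leq_card_setU _ _) _; rewrite leq_add2l.
apply: (@leq_trans (\sum_(x in A :\: S) c)); last by rewrite sum_nat_const leq_mul2r Aa orbT.
apply: leq_sum => x; rewrite inE => /andP[xS xA]; apply: next.
  by rewrite cardsU1 (disjointFr dAX xA) Xj.
by rewrite -setI_eq0 setIUl setU_eq0 !setI_eq0 disjoints1 xS.
Qed.

Lemma branch_iter H S j a c d :
    (forall B, B \in H -> [disjoint B & S]) ->
    (forall X, j <= #|X| < j + d -> [disjoint X & S] -> above H X != set0 ->
       exists A, [/\ [disjoint A & X], #|A :\: S| <= a &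
                     forall B, B \in above H X -> ~~ [disjoint A & B]]) ->
    (forall X, #|X| = j + d -> [disjoint X & S] -> #|above H X| <= c) ->
  forall X, #|X| = j -> [disjoint X & S] -> #|above H X| <= a ^ d * c.
Proof.
move=> dHS; elim: d j => [|d IH] j br next.
  by move=> X Xj; rewrite mul1n; apply: next; rewrite addn0.
rewrite expnS -mulnA; apply: branch_step => //.
  by move=> X Xj; apply: br; rewrite Xj leqnn addnS ltnS leq_addr.
apply: IH => [X /andP[jX Xd]|X Xd]; last by apply: next; rewrite Xd addSnnS.
by apply: br; rewrite (ltnW jX) -addSnnS.
Qed.

Lemma card_above_uniform H S X k :
    (forall B, B \in H -> #|B| = k) -> (forall B, B \in H -> [disjoint B & S]) ->
    [disjoint X & S] -> #|X| <= k ->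
  #|above H X| <= 'C(#|T| - #|S| - #|X|, k - #|X|).
Proof.
move=> Hk dHS dXS Xk.
have cS : #|~: (S :|: X)| = #|T| - #|S| - #|X|.
  by rewrite cardsCs setCK cardsU setIC disjoint_setI0 // cards0 subn0 subnDA.
rewrite -cS -cards_draws.
rewrite -(@card_in_imset _ _ (fun B => B :\: X) (mem (above H X))).
  apply: subset_leq_card; apply/subsetP => D /imsetP[B /setIdP[BH sXB] ->].
  rewrite inE -(Hk B BH) cardsDS // eqxx andbT.
  rewrite setCU setDE setSI // -disjoints_subset; exact: dHS.
move=> B C /setIdP[_ sB] /setIdP[_ sC] eq.
by rewrite -(setID B X) -(setID C X) (setIidPr sB) (setIidPr sC) eq.
Qed.

Lemma above0 H : above H set0 = H.
Proof. by apply/setP => B; rewrite inE sub0set andbT. Qed.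

End Branching.

(** * Diversity, covering number and saturation *)

Section Diversity.

Variable n : nat.
Implicit Types (F H W : {set {set 'I_n}}) (A B S X Y Z : {set 'I_n}).

Lemma gammaP l F c :
    (forall S, #|S| = l -> c <= #|avoid F S|) -> c <= #|F| -> c <= gamma l F.
Proof.
move=> hS hF; apply: (big_ind (fun d => c <= d)) => //; first by move=> x y cx cy; rewrite leq_min cx.
by move=> S /eqP; apply: hS.
Qed.

Lemma gamma_le l F S : #|S| = l -> gamma l F <= #|avoid F S|.
Proof.
move=> Sl; rewrite /gamma; have := mem_index_enum S.
elim: index_enum => //= S' s IH; rewrite big_cons inE => /orP[/eqP <-|/IH le].
  by rewrite Sl eqxx geq_minl.
by case: ifP => // _; rewrite geq_min le orbT.
Qed.

Lemma tau_le F X : hits F X -> tau F <= #|X|.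
Proof.
move=> hX; rewrite /tau; have := mem_index_enum X.
elim: index_enum => //= Y s IH; rewrite big_cons inE => /orP[/eqP <-|/IH le].
  by move: hX; rewrite /hits => ->; rewrite geq_minl.
by case: ifP => // _; rewrite geq_min le orbT.
Qed.

Lemma tau_eq F m :
    (exists2 X, hits F X & #|X| = m) -> (forall X, #|X| < m -> ~~ hits F X) ->
  tau F = m.
Proof.
move=> [X hX Xm] lo; apply/eqP; rewrite eqn_leq; apply/andP; split; first by rewrite -Xm tau_le.
(* The default [n] of [tau] is at least [m] because [X] has [m] points. *)
apply: (big_ind (fun d => m <= d)) => //; first by rewrite -Xm -[leqRHS]card_ord max_card.
  by move=> x y mx my; rewrite leq_min mx.
by move=> Y hY; rewrite leqNgt; apply/negP => /lo/negP; apply.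
Qed.

(* If every member of [W] meeting [S] met [X], then [X] plus one point of a member of [W] missing [X] would beat [S]. *)
Lemma optimal_branch l W W' S X :
    W' \subset W -> set0 \notin W -> (forall Y, #|Y| = l -> ~~ hits W Y) -> l <= n ->
    hits W' S ->
    (forall Y, #|Y| = l -> hits W' Y -> #|avoid W S| <= #|avoid W Y|) ->
    #|X| < l ->
  exists A, [/\ A \in W, [disjoint A & X] & ~~ [disjoint A & S]].
Proof.
move=> sW' W0 nh ln hS opt Xl.
have [/exists_inP[A AW /andP[dAX nAS]]|] := boolP [exists A in W, [disjoint A & X] && ~~ [disjoint A & S]].
  by exists A.
rewrite negb_exists_in => /forall_inP none.
have {}none A : A \in W -> [disjoint A & X] -> [disjoint A & S].
  by move=> AW dAX; have := none A AW; rewrite dAX /= negbK.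
have lT : l <= #|[set: 'I_n]| by rewrite cardsT card_ord.
have [Y /andP[sXY _] Yl] := exists_superset (subsetT X) (ltnW Xl) lT.
have /nhitsP[A AW dAY] := nh Y Yl.
have /set0Pn[y yA] : A != set0 by apply: contraNneq W0 => <-.
have dAX : [disjoint A & X] by apply: disjointWr dAY.
have [|Z /andP[sZ _] Zl] := @exists_superset _ (y |: X) _ l (subsetT _) _ lT.
  by rewrite cardsU1 (leq_trans _ Xl) // -add1n leq_add2r leq_b1.
have sXZ : X \subset Z := subset_trans (subsetUr _ _) sZ.
have hZ : hits W' Z.
  apply: (hitsS sXZ); apply/hitsP => B BW'.
  have := hitsP _ _ hS B BW'; apply: contra; apply: none; exact: (subsetP sW').
have := opt Z Zl hZ; rewrite leqNgt => /negP[]; apply: proper_card.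
apply/properP; split.
  apply/subsetP => B; rewrite !inE => /andP[BW dBZ]; rewrite BW /=.
  by apply: none => //; apply: disjointWr dBZ.
exists A; rewrite !inE AW ?none //=.
rewrite -setI_eq0; apply/set0Pn; exists y; rewrite inE yA.
by rewrite (subsetP sZ) // setU11.
Qed.

(** [t] is the number of points chosen before the plain binomial count. It will be [r] if
    [r > l + 1], and [l + 2] if [r = l + 1]: there [H] leaves out the sets containing a transversal
    of size [l + 1], which allows one more choice. *)
Lemma branching_bound k l r t F H S :
    uniform k F -> intersecting F -> H \subset avoid F S -> #|S| = l -> l < t <= k ->
    (forall X, #|X| = l -> ~~ hits (transversals F r) X) ->
    (forall X, #|X| < l -> exists A,
       [/\ A \in transversals F r, [disjoint A & X] & ~~ [disjoint A & S]]) ->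
    (forall X, l < #|X| < t -> above H X != set0 -> ~~ hits F X) ->
  #|H| <= r.-1 ^ l * (r * (k ^ (t - l.+1) * 'C(n - l - t, k - t))).
Proof.
move=> Fk Fi sHF Sl /andP[lt tk] nh opt nt.
have HF B : B \in H -> B \in F by move/(subsetP sHF); rewrite inE => /andP[].
have HS B : B \in H -> [disjoint B & S] by move/(subsetP sHF); rewrite inE => /andP[].
have aF X B : B \in above H X -> B \in F by rewrite inE => /andP[/HF].
rewrite -[H]above0; apply: (@branch_iter _ H S 0); rewrite ?cards0 ?add0n //; first last.
- by rewrite disjoints_subset sub0set.
- move=> X Xl; apply: (@branch_step _ H S l) => //.
    move=> Y Yl dYS _; have /nhitsP[A] := nh Y Yl.
    rewrite inE => /andP[/hitsP hA Ar] dAY; exists A; split=> //.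
      by apply: leq_trans Ar; apply: subset_leq_card; apply: subsetDl.
    by move=> B /aF/hA; rewrite disjoint_sym.
  apply: (@branch_iter _ H S l.+1) => //.
    move=> Y; rewrite subnKC // => Yt dYS nz.
    have /nhitsP[A AF dAY] := nt Y Yt nz; exists A; split=> //.
      by rewrite -(Fk A AF); apply: subset_leq_card; apply: subsetDl.
    by move=> B /aF BF; rewrite -setI_eq0; apply: Fi.
  move=> Y; rewrite subnKC // => Yt dYS.
  have := @card_above_uniform _ H S Y k; rewrite Yt Sl card_ord; apply => //.
  by move=> B /HF/Fk.
- move=> X; rewrite leq0n /= => Xl dXS _.
  have [A [AW dAX nAS]] := opt X Xl; exists A; split=> //.
    (* [A] has at most [r] points and loses at least one of them to [S]. *)
    move: AW; rewrite inE => /andP[_]; rewrite -(cardsID S A) => le.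
    have: 0 < #|A :&: S| by rewrite card_gt0 setI_eq0.
    move=> p; rewrite -ltnS (leq_trans _ (leqSpred r)) // (leq_trans _ le) //.
    by rewrite -add1n leq_add2r.
  by move: AW; rewrite inE => /andP[/hitsP hA _] B /aF/hA; rewrite disjoint_sym.
Qed.

(** An inclusion-maximal family already contains every [k]-set that could be added; [A != set0]
    ensures that [A] meets itself when [k = 0]. *)
Lemma exists_saturated k F : uniform k F -> intersecting F ->
  exists F', [/\ F \subset F', uniform k F', intersecting F' &
    forall A, #|A| = k -> A != set0 -> hits F' A -> A \in F'].
Proof.
move=> Fk Fi.
pose p (G : {set {set 'I_n}}) :=
  [forall A in G, #|A| == k] && [forall A in G, forall B in G, A :&: B != set0].
have pP G : reflect (uniform k G /\ intersecting G) (p G).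
  apply: (iffP andP) => [[/forall_inP Gk /forall_inP Gi]|[Gk Gi]]; split.
  - by move=> A /Gk/eqP.
  - by move=> A B /Gi/forall_inP; apply.
  - by apply/forall_inP => A /Gk/eqP.
  - by apply/forall_inP => A AG; apply/forall_inP => B; apply: Gi.
have [G /maxsetP[/pP[Gk Gi] Gmax] sFG] := maxset_exists (introT (pP F) (conj Fk Fi)).
exists G; split=> // A Ak A0 /hitsP hA.
have -> : G = A |: G; last exact: setU11.
apply/esym/Gmax; last exact: subsetUr.
apply/pP; split=> [B /setU1P[->|/Gk]//|B C /setU1P[->|BG] /setU1P[->|CG]].
- by rewrite setIid.
- by rewrite setIC setI_eq0 hA.
- by rewrite setI_eq0 hA.
- exact: Gi.
Qed.

(** If [A] and [B] were disjoint, [A] would extend to a [k]-set missing [B]; saturation puts this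
    set in [F], so [B] would not be a transversal. *)
Lemma transversals_intersecting k F A B :
    (forall A, #|A| = k -> A != set0 -> hits F A -> A \in F) -> 2 * k <= n -> 0 < k ->
    #|A| <= k -> #|B| <= k -> hits F A -> hits F B ->
  A :&: B != set0.
Proof.
move=> sat kn k0 Ak Bk hA hB; rewrite setI_eq0; apply/negP => dAB.
have kB : k <= #|~: B| by rewrite cardsCs setCK card_ord; lia.
have sAB : A \subset ~: B by rewrite -disjoints_subset.
have [C /andP[sAC sCB] Ck] := exists_superset sAB Ak kB.
have CF : C \in F by apply: sat (hitsS sAC hA) => //; rewrite -card_gt0 Ck.
by have := hitsP _ _ hB C CF; rewrite disjoints_subset sCB.
Qed.

(** Branching with [S] empty: fewer than [q] points are missed by some member, which offers [q]
    choices, and [q] points determine a member. *)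
Lemma card_tau_le q F : uniform q F -> intersecting F -> tau F = q -> #|F| <= q ^ q.
Proof.
move=> Fq Fi tq; rewrite -[F]above0 -[_ ^ _]muln1.
apply: (@branch_iter _ F set0 0); rewrite ?cards0 //.
- by move=> B _; rewrite -setI_eq0 setI0.
- move=> X /andP[_ Xq] _ _; have /nhitsP[A AF dAX] : ~~ hits F X.
    by apply/negP => /tau_le; rewrite tq leqNgt Xq.
  exists A; split=> //; first by rewrite setD0 (Fq A AF).
  by move=> B; rewrite inE => /andP[BF _]; rewrite -setI_eq0; apply: Fi.
- move=> X Xq dX; rewrite -(bin0 (n - 0 - q)).
  have := @card_above_uniform _ F set0 X q; rewrite Xq cards0 card_ord subnn; apply=> //.
  by move=> B _; rewrite -setI_eq0 setI0.
- by rewrite -setI_eq0 setI0.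
Qed.

Lemma gamma_tau_le l F :
  uniform l.+1 F -> intersecting F -> tau F = l.+1 -> gamma l F <= l.+1 ^ l.
Proof.
move=> Fl Fi tl; have /nhitsP[A AF _] : ~~ hits F set0.
  by apply/negP => /tau_le; rewrite tl cards0.
rewrite -(@leq_pmul2l l.+1) // -expnS; apply: leq_trans (card_tau_le Fl Fi tl).
rewrite -{1}(Fl A AF) -sum_nat_const.
apply: (@leq_trans (\sum_(x in A) \sum_(B in F) [disjoint B & A :\ x])).
  apply: leq_sum => x xA; apply: leq_trans (@gamma_le l F (A :\ x) _) _.
    by have := cardsD1 x A; rewrite xA (Fl A AF) => -[].
  rewrite -big_mkcondr /= sum1_card; apply: subset_leq_card.
  by apply/subsetP => B; rewrite inE.
(* [B] meets [A] in some [y], so only [x = y] can make [A :\ x] miss [B]. *)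
rewrite exchange_big /= -sum1_card; apply: leq_sum => B BF.
have /set0Pn[y /setIP[yA yB]] := Fi A B AF BF.
rewrite (bigD1 y) //= big1 ?addn0 ?leq_b1 // => x /andP[xA xy].
apply/eqP; rewrite eqb0 -setI_eq0; apply/set0Pn; exists y.
by rewrite !inE yB yA eq_sym xy.
Qed.

End Diversity.

(** * Existence and size of the maximum [m_ell] *)

Lemma is_m_ell_m_ell l : is_m_ell l (l + 1) (m_ell l (l + 1)).
Proof.
apply: epsilon_spec; rewrite addn1.
pose P m := exists n (F : {set {set 'I_n}}),
  [/\ uniform l.+1 F, intersecting F, tau F = l.+1 & gamma l F = m].
pose p m : bool := if excluded_middle_informative (P m) then true else false.
have pP m : reflect (P m) (p m).
  by rewrite /p; case: excluded_middle_informative => h; constructor.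
have exP : exists m, p m.
  (* Among [2 * l + 1] points, two sets of size [l + 1] always meet, and any [l] points leave such a
     set untouched. *)
  pose F := [set A : {set 'I_(2 * l).+1} | #|A| == l.+1].
  have Fi : intersecting F.
    move=> A B; rewrite !inE => /eqP Al /eqP Bl; apply/negP => /eqP dAB.
    have := max_card (mem (A :|: B)); rewrite card_ord cardsU dAB cards0 Al Bl; lia.
  exists (gamma l F); apply/pP; exists (2 * l).+1, F; split=> //.
  - by move=> A; rewrite inE => /eqP.
  apply: tau_eq => [|X Xl].
    have [||A _ Al] := @exists_superset _ set0 [set: 'I_(2 * l).+1] l.+1 (sub0set _).
    - by rewrite cards0.
    - by rewrite cardsT card_ord ltnS leq_pmull.
    exists A => //; apply/hitsP => B BF; rewrite -setI_eq0; apply: Fi => //.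
    by rewrite inE Al.
  have [||A /andP[_ sA] Al] := @exists_superset _ set0 (~: X) l.+1 (sub0set _).
  - by rewrite cards0.
  - by rewrite cardsCs setCK card_ord; lia.
  by apply/nhitsP; exists A; rewrite ?inE ?Al // disjoints_subset.
have bdP m : p m -> m <= l.+1 ^ l.
  by move/pP => [n [F [Fl Fi tF <-]]]; apply: gamma_tau_le.
have [m /pP Pm mmax] := ex_maxnP exP bdP.
exists m; split=> // n F Fl Fi tF; apply: mmax; apply/pP.
by exists n, F.
Qed.

Lemma m_ell_le l : m_ell l (l + 1) <= l.+1 ^ l.
Proof.
have [[n [F [Fl Fi tF <-]]] _] := is_m_ell_m_ell l.
by rewrite addn1 in Fl tF; apply: gamma_tau_le.
Qed.

(** * The bound for saturated families *)

Lemma saturated_bound n k l (F : {set {set 'I_n}}) :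
    let m := m_ell l (l + 1) in
    0 < l < k -> uniform k F -> intersecting F ->
    (forall A : {set 'I_n}, #|A| = k -> A != set0 -> hits F A -> A \in F) ->
    ((l + 2) * (l + 1) ^ l - (l + 1) * l ^ l) * k ^ 2 <= n * m ->
  exists2 S : {set 'I_n}, #|S| = l &
    #|avoid F S| <= m * 'C(n - 2 * l - 1, k - l - 1)
      + (if l.+2 <= k then (l + 1) * l ^ l * k * 'C(n - 2 * l - 2, k - l - 2) else 0).
Proof.
move=> m /andP[l0 lk] Fk Fi sat thr.
have [_ m_max] := is_m_ell_m_ell l; rewrite -/m addn1 in m_max.
have n_quad := threshold_leq l0 thr (m_ell_le l).
have nk : 2 * k <= n by nia.
have ln : l <= n by lia.
have lT : l <= #|[set: 'I_n]| by rewrite cardsT card_ord.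
have extend (X : {set 'I_n}) : #|X| <= l -> exists2 S : {set 'I_n}, X \subset S & #|S| = l.
  by move=> Xl; have [S /andP[sXS _] Sl] := exists_superset (subsetT X) Xl lT; exists S.
have [/existsP[S /andP[/eqP Sl hS]]|nex] := boolP [exists S : {set 'I_n}, (#|S| == l) && hits F S].
  exists S => //; suff -> : avoid F S = set0 by rewrite cards0.
  by apply/setP => A; rewrite !inE; apply/negP => /andP[/(hitsP _ _ hS)/negP].
have nhF (X : {set 'I_n}) : #|X| <= l -> ~~ hits F X.
  move=> /extend[S sXS Sl]; apply: contra nex => hX; apply/existsP; exists S.
  by rewrite Sl eqxx (hitsS sXS hX).
pose p r := [forall S : {set 'I_n}, (#|S| == l) ==> ~~ hits (transversals F r) S].
(* The members of [F] are themselves transversals of size [k]. *)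
have pk : p k.
  apply/forallP => S; apply/implyP => /eqP Sl.
  have /nhitsP[A AF dAS] := nhF S (eq_leq Sl).
  apply/nhitsP; exists A => //; rewrite inE (Fk A AF) leqnn andbT.
  by apply/hitsP => B BF; rewrite -setI_eq0; apply: Fi.
have [r pr rmin] := ex_minnP (ex_intro p k pk).
have rk : r <= k := rmin k pk.
have lr : l < r.
  rewrite ltnNge; apply/negP => rl; have [S _ Sl] := @extend set0 (leq_trans (eq_leq (cards0 _)) (leq0n _)).
  have /forallP/(_ S) := pr; rewrite Sl eqxx => /nhitsP[A].
  by rewrite inE => /andP[hA Ar] _; move: (nhF A (leq_trans Ar rl)); rewrite hA.
have nhW (X : {set 'I_n}) : #|X| = l -> ~~ hits (transversals F r) X.
  by move=> Xl; have /forallP/(_ X) := pr; rewrite Xl eqxx.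
have [S0 S0P] : exists S0 : {set 'I_n}, (#|S0| == l) && hits (transversals F r.-1) S0.
  have : ~~ p r.-1 by apply/negP => /rmin; lia.
  by rewrite negb_forall => /existsP[S]; rewrite negb_imply negbK; exists S.
have [S /andP[/eqP Sl hS] Smin] := @arg_minnP _ S0
  (fun S : {set 'I_n} => (#|S| == l) && hits (transversals F r.-1) S)
  (fun S => #|avoid (transversals F r) S|) S0P.
have {}Smin (Y : {set 'I_n}) : #|Y| = l -> hits (transversals F r.-1) Y ->
    #|avoid (transversals F r) S| <= #|avoid (transversals F r) Y|.
  by move=> Yl hY; apply: Smin; rewrite Yl eqxx.
have opt (X : {set 'I_n}) : #|X| < l -> exists A : {set 'I_n},
    [/\ A \in transversals F r, [disjoint A & X] & ~~ [disjoint A & S]].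
  move=> Xl; apply: (optimal_branch _ _ nhW ln hS Smin Xl).
    by apply/subsetP => A; rewrite !inE => /andP[-> /leq_trans->] //; apply: leq_pred.
  by rewrite inE negb_and nhF ?cards0.
exists S => //.
have [rl|] := eqVneq r l.+1; last first.
  move=> rl; have {}lr : l.+2 <= r by lia.
  have lk2 : l.+2 <= k := leq_trans lr rk.
  rewrite lk2; apply: leq_trans (branch_count_final thr nk lk2).
  apply: leq_trans (branch_count_le n_quad nk (introT andP (conj lr rk))).
  apply: (branching_bound Fk Fi (subxx _) Sl _ nhW opt); first by rewrite rk andbT ltnW.
  (* A transversal with fewer than [r] points meets [S], so it cannot lie in a set [B] that misses
     [S]. *)
  move=> X /andP[_ Xr] /set0Pn[B]; rewrite !inE => /andP[/andP[_ dBS] sXB].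
  apply/negP => hX; have XW : X \in transversals F r.-1 by rewrite inE hX -ltnS prednK //; lia.
  by have /negP[] := hitsP _ _ hS X XW; apply: disjointWl sXB dBS.
subst r; set G := transversals F l.+1 in nhW Smin opt.
have GP (A : {set 'I_n}) : (A \in G) = hits F A && (#|A| == l.+1).
  rewrite inE; case hA : (hits F A) => //=.
  rewrite eqn_leq; case: (leqP l.+1 #|A|) => [|Al]; rewrite ?andbT ?andbF //.
  by have := nhF A Al; rewrite hA.
have Gl : uniform l.+1 G by move=> A; rewrite GP => /andP[_ /eqP].
have Gi : intersecting G.
  move=> A B AG BG; have k0 : 0 < k by lia.
  apply: (transversals_intersecting sat nk k0); rewrite ?(Gl A AG) ?(Gl B BG) //.
    by move: AG; rewrite GP => /andP[].
  by move: BG; rewrite GP => /andP[].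
have tG : tau G = l.+1.
  apply: tau_eq => [|X Xl].
    have /nhitsP[A AG _] := nhW S Sl; exists A; last exact: Gl.
    by apply/hitsP => B BG; rewrite -setI_eq0; apply: Gi.
  have [Y sXY Yl] := extend X Xl.
  by apply: contra (nhW Y Yl); apply: hitsS.
(* No transversal has at most [l] points, so every [l]-set is a candidate in the choice of [S];
   hence [S] attains the diversity of [G]. *)
have avG : #|avoid G S| <= m.
  apply: leq_trans (m_max n G Gl Gi tG); apply: gammaP => [Y Yl|].
    apply: Smin => //; apply/hitsP => A; rewrite inE => /andP[hA Al].
    by have := nhF A Al; rewrite hA.
  by apply: subset_leq_card; apply/subsetP => A; rewrite inE => /andP[].
pose H := [set B in avoid F S | ~~ [exists A in G, A \subset B]].
have sub : avoid F S \subset (\bigcup_(A in avoid G S) above (avoid F S) A) :|: H.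
  apply/subsetP => B BF; rewrite in_setU [B \in H]inE BF /=.
  have [/exists_inP[A AG sAB]|] := boolP [exists A in G, A \subset B]; last by rewrite orbT.
  rewrite orbF; apply/bigcupP; exists A; last by rewrite inE BF.
  by move: BF; rewrite !inE -/G in AG * => /andP[_ dBS]; rewrite AG (disjointWl sAB dBS).
apply: leq_trans (subset_leq_card sub) _; apply: leq_trans (leq_card_setU _ _) _.
apply: leq_add.
  apply: leq_trans (leq_mul avG (leqnn _)); rewrite -sum_nat_const.
  apply: (@leq_trans (\sum_(A in avoid G S) #|above (avoid F S) A|)).
    elim/big_rec2: _ => [|A x U _ IH]; first by rewrite cards0.
    by apply: leq_trans (leq_card_setU _ _) _; rewrite leq_add2l.
  apply: leq_sum => A /setIdP[AG dAS].
  have := @card_above_uniform _ (avoid F S) S A k; rewrite (Gl A AG) Sl card_ord.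
  have -> : n - l - l.+1 = n - 2 * l - 1 by lia.
  have -> : k - l.+1 = k - l - 1 by lia.
  by apply => //; move=> B /setIdP[] // /Fk.
have nH (X : {set 'I_n}) : #|X| = l.+1 -> above H X != set0 -> ~~ hits F X.
  move=> Xl /set0Pn[B /setIdP[/setIdP[_ nB] sXB]]; apply: contra nB => hX.
  by apply/exists_inP; exists X; rewrite // GP hX Xl eqxx.
(* For [k = l + 1] the truncated index [k - l - 2] would give a binomial equal to 1 instead of 0,
   hence the [if]. In that case [H] is empty, since each member of [F] is a transversal of size
   [l + 1]. *)
have [lk2|kl] := leqP l.+2 k.
  have sHF : H \subset avoid F S by apply/subsetP => B /setIdP[].
  have := @branching_bound n k l l.+1 l.+2 F H S Fk Fi sHF Sl _ nhW opt.
  rewrite ltnW ?lk2 // => /(_ isT); rewrite subSnn expn1 /=.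
  have -> : n - l - l.+2 = n - 2 * l - 2 by lia.
  have -> : k - l.+2 = k - l - 2 by lia.
  have -> : l ^ l * (l.+1 * (k * 'C(n - 2 * l - 2, k - l - 2))) =
    (l + 1) * l ^ l * k * 'C(n - 2 * l - 2, k - l - 2) by lia.
  by apply=> X /andP[lX Xl]; apply: nH; apply/eqP; rewrite eqn_leq -ltnS Xl lX.
rewrite leqn0 cards_eq0; apply/eqP/setP => B; rewrite in_set0; apply/negP => BH.
have BF : B \in F by move: BH => /setIdP[/setIdP[]].
have Bl : #|B| = l.+1 by rewrite (Fk B BF); lia.
have nz : above H B != set0 by apply/set0Pn; exists B; rewrite inE BH subxx.
have /negP := nH B Bl nz; apply; apply/hitsP => C CF.
by rewrite -setI_eq0; apply: Fi.
Qed.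

Theorem theorem1p1 (n k l : nat) :
  2 <= l -> l < k ->
  (((l + 2) * (l + 1) ^ l - (l + 1) * l ^ l) * k ^ 2 <= n * m_ell l (l + 1))%N ->
  forall F : {set {set 'I_n}}, uniform k F -> intersecting F ->
  (gamma l F <=
     m_ell l (l + 1) * binz (n%:Z - (2 * l)%:Z - 1) (k%:Z - l%:Z - 1)
     + (l + 1) * l ^ l * k * binz (n%:Z - (2 * l)%:Z - 2) (k%:Z - l%:Z - 2))%N.
Proof.
move=> l2 lk thr F Fk Fi.
have [F' [sFF' F'k F'i sat]] := exists_saturated Fk Fi.
have l0k : 0 < l < k by rewrite lk andbT ltnW.
have [S Sl] := saturated_bound l0k F'k F'i sat thr.
have nk := threshold_leq (ltnW l2) thr (m_ell_le l).
(* This gives [k - l - 1 <= n - 2 * l - 1], so that [binz] is the ordinary binomial. *)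
have kn : 2 * k <= n by nia.
have -> : binz (n%:Z - (2 * l)%:Z - 1) (k%:Z - l%:Z - 1) = 'C(n - 2 * l - 1, k - l - 1).
  rewrite /binz ifT; last by lia.
  by congr 'C(_, _); lia.
move=> bound; apply: leq_trans (gamma_le F Sl) _.
apply: (@leq_trans #|avoid F' S|).
  by apply: subset_leq_card; apply/subsetP => A; rewrite !inE => /andP[/(subsetP sFF')->].
apply: leq_trans bound _; rewrite leq_add2l; case: ifP => // lk2.
rewrite /binz ifT; last by lia.
rewrite leq_eqVlt; apply/orP; left; apply/eqP; congr (_ * 'C(_, _)); lia.
Qed.
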